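(* $c\ell\, K(\beta S_0)\subsetneq \bigcap_{n=1}^\infty R_n$, where for $n\in\mathbb N$, $R_n=\{p\in\beta S_0:\ \forall B\in p\ \exists w\in S_n \text{ with } \{w(\vec x):\vec x\in\mathbb A^n\}\subseteq B\}$.
   Context: $\mathbb A$ is a fixed nonempty finite alphabet, $S_0=\mathbb A^+$ the free semigroup of nonempty words over $\mathbb A$, $v_1,v_2,\dots$ distinct variables not in $\mathbb A$, and $S_n$ the set of nonempty words over $\mathbb A\cup\{v_1,\dots,v_n\}$ in which every $v_i$ ($i\le n$) occurs. For $\vec x=(x_1,\dots,x_n)\in\mathbb A^n$, $w(\vec x)$ replaces each occurrence of $v_i$ in $w$ by $x_i$. $\beta S_0$ is the Stone–Čech compactification of the discrete semigroup $S_0$ with the extended operation ($A\in pq$ iff $\{x:x^{-1}A\in q\}\in p$), a compact Hausdorff right topological semigroup; $K(\beta S_0)$ is its smallest two-sided ideal and $c\ell$ denotes closure in $\beta S_0$. *)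

(* Defs.v *)
From HB Require Import structures.
From mathcomp Require Import all_boot.
From mathcomp Require Import all_classical topology_structure.

Set Implicit Arguments.
Unset Strict Implicit.
Unset Printing Implicit Defensive.

Local Open Scope classical_set_scope.

Section Words.
Variable A : choiceType.

Record word := Word { letters :> seq A; _ : letters != [::] }.

HB.instance Definition _ := [isSub for letters].
HB.instance Definition _ := [Choice of word by <:].

Fact cat_word_subproof (u v : word) : (u : seq A) ++ (v : seq A) != [::].
Proof. by case: u => [[]]. Qed.

Definition cat_word (u v : word) : word := Word (cat_word_subproof u v).

Fact cat_wordA : associative cat_word.
Proof. by move=> u v w; apply: val_inj; rewrite /= catA. Qed.

HB.instance Definition _ := isSemigroup.Build word cat_wordA.

End Words.

(* The Stone-Cech compactification of a discrete space, as the space of its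
   ultrafilters. *)

Record beta (S : Type) := Beta {
  members : set_system S;
  #[global] members_ultra :: UltraFilter members
}.

Lemma beta_eq (S : Type) (p q : beta S) : members p = members q -> p = q.
Proof.
case: p q => [F FU] [G GU] /= FG; rewrite -FG in GU *.
by congr Beta; apply: Prop_irrelevance.
Qed.

HB.instance Definition _ (S : Type) := gen_eqMixin (beta S).
HB.instance Definition _ (S : Type) := gen_choiceMixin (beta S).

Section BetaTopology.
Variable S : Type.

Definition beta_basic (A : set S) : set (beta S) := [set p | members p A].

Fact beta_basic_cover : \bigcup_(A in [set: set S]) beta_basic A = setT.
Proof. by apply/seteqP; split=> // p _; exists setT => //; apply: filterT. Qed.

Fact beta_basic_join (A B : set S) (p : beta S) :
  [set: set S] A -> [set: set S] B -> beta_basic A p -> beta_basic B p ->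
  exists C, [/\ [set: set S] C, beta_basic C p &
                beta_basic C `<=` beta_basic A `&` beta_basic B].
Proof.
move=> _ _ pA pB; exists (A `&` B); split=> //; first exact: filterI.
by move=> q qAB; split; apply: filterS qAB => x [].
Qed.

HB.instance Definition _ :=
  isBaseTopological.Build (beta S) beta_basic_cover beta_basic_join.

End BetaTopology.

Section BetaSemigroup.
Variable S : semigroupType.

Definition beta_mul_sets (p q : beta S) : set_system S :=
  [set A | members p [set x | members q [set y | A (x * y)%g]]].

Fact beta_mul_ultra (p q : beta S) : UltraFilter (beta_mul_sets p q).
Proof.
have FF : ProperFilter (beta_mul_sets p q).
  have pqE : ~ beta_mul_sets p q set0.
    rewrite /beta_mul_sets /= => pq0; apply: (@filter_not_empty _ (members p)).
    by apply: filterS pq0 => x /filter_not_empty.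
  suff ? : Filter (beta_mul_sets p q) by exact: Build_ProperFilter.
  rewrite /beta_mul_sets; split=> /=.
  - by apply: filterS filterT => x _; apply: filterT.
  - by move=> B C /=; apply: filterS2 => x /=; apply: filterS2 => y; split.
  - move=> B C BC; apply: filterS => x; apply: filterS => y; exact: BC.
split=> // G GF FG; apply/seteqP; split=> // B GB.
have [//|pC] := in_ultra_setVsetC [set x | members q [set y | B (x * y)%g]] (members_ultra p).
exfalso; apply: (@filter_not_empty _ G); rewrite -(setICr B).
apply: filterI => //; apply: FG; apply: filterS pC => x qB.
by have [|] := in_ultra_setVsetC [set y | B (x * y)%g] (members_ultra q).
Qed.

Definition beta_mul (p q : beta S) : beta S := Beta (beta_mul_ultra p q).

Fact beta_mulA : associative beta_mul.
Proof.
move=> p q r; apply: beta_eq; apply/funext => B /=.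
rewrite /beta_mul_sets /=; congr (members p _); apply/funext => x /=.
congr (members q _); apply/funext => y /=.
by congr (members r _); apply/funext => z /=; rewrite mulgA.
Qed.

HB.instance Definition _ := isSemigroup.Build (beta S) beta_mulA.

End BetaSemigroup.

Definition two_sided_ideal (S : semigroupType) (I : set S) : Prop :=
  I !=set0 /\ forall s x : S, I x -> I (s * x)%g /\ I (x * s)%g.

(* The intersection of all two-sided ideals: it is the smallest one whenever there
   is a smallest one, as in every compact right topological semigroup. *)
Definition smallest_ideal (S : semigroupType) : set S :=
  smallest (@two_sided_ideal S) set0.

(* In the alphabet [A + 'I_n], [inl a] is the letter [a] of [A] and [inr i] is
   the variable v_{i+1}. *)
Section VariableWords.
Variables (A : finType) (n : nat).

Definition variable_words : set (word (A + 'I_n)%type) :=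
  [set w | forall i : 'I_n, inr i \in letters w].

Definition subst_letter (x : n.-tuple A) (c : A + 'I_n) : A :=
  match c with inl a => a | inr i => tnth x i end.

Fact word_subst_subproof (w : word (A + 'I_n)%type) (x : n.-tuple A) :
  map (subst_letter x) (letters w) != [::].
Proof. by case: w => [[]]. Qed.

Definition word_subst (w : word (A + 'I_n)%type) (x : n.-tuple A) : word A :=
  Word (word_subst_subproof w x).

Definition R_ : set (beta (word A)) :=
  [set p | forall B : set (word A), members p B ->
    exists2 w, variable_words w & [set word_subst w x | x in [set: n.-tuple A]] `<=` B].

End VariableWords.

(* Main.v *)
(* Each R_n is closed, and it is a two-sided ideal once it is nonempty, so it
   contains the closure of the smallest ideal.  For strictness, let B be the set
   of words whose length is a power of 2.  By the Hales-Jewett theorem, which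
   applies to words of every sufficiently large length, every finite partition
   of B has, for each n, a class containing all instances of some w in S_n;
   hence B belongs to some p in every R_n.  On the other hand, the products qr,
   where q and r are ultrafilters along which the word length tends to infinity,
   form a two-sided ideal, and no such product contains B. *)
Require Import Defs.
From mathcomp Require Import all_boot.
From mathcomp Require Import all_classical topology_structure.

Set Implicit Arguments.
Unset Strict Implicit.
Unset Printing Implicit Defensive.

Local Open Scope classical_set_scope.

Section HalesJewett.
Variable T : finType.

Definition fill (x : T) (w : seq (option T)) : seq T := map (odflt x) w.

Lemma fill_cat x u v : fill x (u ++ v) = fill x u ++ fill x v.
Proof. exact: map_cat. Qed.

Lemma fill_some x u : fill x (map some u) = u.
Proof. by rewrite /fill -map_comp map_id. Qed.

Definition monochromatic (K : eqType) (c : seq T -> K) (s : seq T)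
  (w : seq (option T)) : Prop :=
  None \in w /\ {in s &, forall x y, c (fill x w) = c (fill y w)}.

Definition hales_jewett_for (s : seq T) : Prop := forall K : finType,
  exists N, forall c : seq T -> K, exists2 w, size w = N & monochromatic c s w.

Definition focused (K : eqType) (c : seq T -> K) (s : seq T) (a : T)
  (f : seq T) (k : K) : Prop :=
  exists w, [/\ None \in w, fill a w = f & {in s, forall x, c (fill x w) = k}].

(* Color focusing: [m] variable words that all become [f] at [a] and are
   monochromatic over [s], with [m] distinct colors.  For [m > #|K|] the second
   alternative is impossible. *)
Lemma focusing (s : seq T) (a : T) (K : finType) (m : nat) :
    s != [::] -> hales_jewett_for s ->
  exists N, forall c : seq T -> K,
    (exists2 w, size w = N & monochromatic c (a :: s) w) \/
    exists f ks, [/\ size f = N, uniq ks, size ks = m &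
                     {in ks, forall k, focused c s a f k}].
Proof.
case: s => // x0 s _ HJ; elim: m => [|m [N focN]].
  by exists 0 => c; right; exists [::], [::].
have [N' HJN'] := HJ {ffun N.-tuple T -> K}.
exists (N' + N) => c.
have [w0 sz0 [var0 mono0]] := HJN' (fun u => [ffun v : N.-tuple T => c (u ++ v)]).
pose c' v := c (fill x0 w0 ++ v).
have c'E x v : x \in x0 :: s -> size v = N -> c (fill x w0 ++ v) = c' v.
  move=> xs /eqP szv; have /ffunP/(_ (Tuple szv)) := mono0 x x0 xs (mem_head _ _).
  by rewrite !ffunE.
have lift_mono w : size w = N -> monochromatic c' (a :: x0 :: s) w ->
    exists2 w', size w' = N' + N & monochromatic c (a :: x0 :: s) w'.
  move=> szw [varw monow]; exists (map some (fill x0 w0) ++ w).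
    by rewrite size_cat !size_map sz0 szw.
  split; first by rewrite mem_cat varw orbT.
  by move=> x y xs ys; rewrite !fill_cat !fill_some; exact: monow.
have [[w szw monow]|[f [ks [szf uks szks foc]]]] := focN c'.
  by left; exact: lift_mono monow.
have [fks|fks] := boolP (c' f \in ks).
  left; have [w [varw wf wk]] := foc _ fks.
  have monow x : x \in a :: x0 :: s -> c' (fill x w) = c' f.
    by rewrite inE => /predU1P[->|/wk//]; rewrite wf.
  apply: (lift_mono w); first by rewrite -szf -wf size_map.
  by split=> // x y /monow-> /monow->.
right; exists (fill a w0 ++ f), (c' f :: ks); split=> /=.
- by rewrite size_cat size_map sz0 szf.
- by rewrite fks.
- by rewrite szks.
move=> k; rewrite inE => /predU1P[->|/foc[w [varw wf wk]]].
  exists (w0 ++ map some f); split; first by rewrite mem_cat var0.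
    by rewrite fill_cat fill_some.
  by move=> x xs; rewrite fill_cat fill_some c'E.
exists (w0 ++ w); split; first by rewrite mem_cat var0.
  by rewrite fill_cat wf.
by move=> x xs; rewrite fill_cat c'E ?wk // -szf -wf !size_map.
Qed.

Lemma hales_jewett (s : seq T) : hales_jewett_for s.
Proof.
elim: s => [|a [|b s] IHs] K.
- by exists 1 => c; exists [:: None].
- exists 1 => c; exists [:: None] => //; split=> // x y.
  by rewrite !inE => /eqP-> /eqP->.
have [N focN] := @focusing (b :: s) a K #|K|.+1 isT IHs.
exists N => c; have [//|[f [ks [_ uks szks _]]]] := focN c.
by have := max_card (mem ks); rewrite (card_uniqP uks) szks ltnn.
Qed.

End HalesJewett.

(* An n-variable word over [A] is a one-variable word over the alphabet [A^n],
   whose variable is expanded to v_1 ... v_n; a constant suffix adjusts the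
   length. *)
Lemma hales_jewett_multi (A K : finType) (n : nat) : 0 < #|A| -> 0 < n ->
  exists N, forall M, N <= M -> forall c : seq A -> K,
    exists w : seq (A + 'I_n), [/\ size w = M, forall i, inr i \in w &
      forall x y : n.-tuple A,
        c (map (subst_letter x) w) = c (map (subst_letter y) w)].
Proof.
move=> /card_gt0P[a0 _] n_gt0.
have [N HJN] := @hales_jewett (n.-tuple A) (enum {: n.-tuple A}) K.
exists (N * n) => M leNM c; pose pad := nseq (M - N * n) a0.
have [w szw [varw monow]] := HJN (fun u => c (flatten (map val u) ++ pad)).
pose block (t : option (n.-tuple A)) : seq (A + 'I_n) :=
  if t is Some u then map inl u else map inr (enum 'I_n).
have substE x : map (subst_letter x) (flatten (map block w) ++ map inl pad) =
    flatten (map val (fill x w)) ++ pad.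
  rewrite map_cat map_flatten -!map_comp map_id; congr (flatten _ ++ _).
  apply: eq_map => -[u|] /=; rewrite -map_comp /= ?map_id //.
  exact: map_tnth_enum.
exists (flatten (map block w) ++ map inl pad); split.
- rewrite size_cat size_map size_nseq.
  suff -> : size (flatten (map block w)) = N * n by exact: subnKC.
  rewrite -szw; elim: (w) => //= t v IHv.
  rewrite size_cat IHv mulSn; congr addn.
  by case: t => [u|]; rewrite /= size_map ?size_enum_ord ?size_tuple.
- move=> i; rewrite mem_cat; apply/orP; left; apply/flatten_mapP.
  by exists None; rewrite //= map_f ?mem_enum.
by move=> x y; rewrite !substE; apply: monow; rewrite mem_enum.
Qed.

Definition contains_variable_word (A : finType) (n : nat) (B : set (word A)) :=
  exists2 w, variable_words w &
    [set word_subst w x | x in [set: n.-tuple A]] `<=` B.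

Lemma contains_variable_word_leq (A : finType) (m n : nat) (B : set (word A)) :
  0 < n -> n <= m -> @contains_variable_word A m B ->
  @contains_variable_word A n B.
Proof.
case: n => // n _ lenm [w varw wB].
pose phi (i : 'I_m) : 'I_n.+1 := inord (minn i n).
pose h (l : A + 'I_m) : A + 'I_n.+1 :=
  match l with inl a => inl a | inr i => inr (phi i) end.
have hw0 : map h (letters w) != [::] by case: (w) => [[]].
exists (Word hw0) => [j|_ [x _ <-]].
  apply/mapP; exists (inr (widen_ord lenm j)); first exact: varw.
  congr inr; apply: val_inj; rewrite /= inordK; last by rewrite ltnS geq_minr.
  by apply/esym/minn_idPl; exact: leq_ord j.
apply: wB; exists [tuple tnth x (phi i) | i < m] => //.
apply: val_inj => /=; rewrite -map_comp; apply: eq_map => -[a|i] //=.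
by rewrite tnth_mktuple.
Qed.

Lemma R_ideal (A : finType) (n : nat) :
  @R_ A n !=set0 -> two_sided_ideal (@R_ A n).
Proof.
move=> R0; split=> // s p Rp; split=> B /= sB.
  have [y pB] := @filter_ex _ (members s) _ _ sB.
  have [w varw wB] := Rp _ pB.
  have yw0 : map inl (letters y) ++ letters w != [::] by case: (y) => [[]].
  exists (Word yw0) => [i|_ [x _ <-]]; first by rewrite mem_cat varw orbT.
  have := wB _ (ex_intro2 _ _ x I erefl); congr B; apply: val_inj => /=.
  by rewrite map_cat -map_comp map_id.
have [w varw wB] := Rp _ sB.
have [|y yB] := @filter_ex _ (members s) _
  [set y | forall x : n.-tuple A, B (word_subst w x * y)%g].
  by apply: filter_forall => x; apply: wB; exists x.
have wy0 : letters w ++ map inl (letters y) != [::] by case: (w) => [[]].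
exists (Word wy0) => [i|_ [x _ <-]]; first by rewrite mem_cat varw.
have := yB x; congr B; apply: val_inj => /=.
by rewrite map_cat -map_comp map_id.
Qed.

Lemma open_beta_basic (S : Type) (B : set S) : open (beta_basic B).
Proof. by exists [set B] => //; rewrite bigcup_set1. Qed.

Lemma closure_beta_meets (S : Type) (K : set (beta S)) (p : beta S)
    (B : set S) :
  closure K p -> members p B -> exists2 q, K q & members q B.
Proof.
move=> Kp pB; have [|q [Kq qB]] := Kp (beta_basic B); last by exists q.
by apply: open_nbhs_nbhs; split=> //; exact: open_beta_basic.
Qed.

Lemma closure_smallest_ideal_sub_R (A : finType) (n : nat) :
  @R_ A n !=set0 -> closure (@smallest_ideal (beta (word A))) `<=` @R_ A n.
Proof.
move=> /R_ideal RI p Kp B /(closure_beta_meets Kp)[q Kq].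
exact: (smallest_sub RI (@sub0set _ _) Kq).
Qed.

Definition length_infinite (A : choiceType) : set (beta (word A)) :=
  [set p | forall m, members p [set w | m <= size (letters w)]].

Lemma length_infinite_mul (A : choiceType) (p q : beta (word A)) :
  length_infinite p \/ length_infinite q -> length_infinite (p * q)%g.
Proof.
move=> pq m.
change (members p [set x | members q [set y | m <= size (letters (x * y)%g)]]).
case: pq => /(_ m) inf.
  apply: filterS inf => x mx; apply: filterS filterT => y _ /=.
  by rewrite size_cat (leq_trans mx) ?leq_addr.
apply: filterS filterT => x _; apply: filterS inf => y my /=.
by rewrite size_cat (leq_trans my) ?leq_addl.
Qed.

Lemma length_infinite_products_ideal (A : choiceType) :
  @length_infinite A !=set0 ->
  two_sided_ideal [set r : beta (word A) | exists p q,
    [/\ length_infinite p, length_infinite q & r = (p * q)%g]].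
Proof.
move=> [p Lp]; split; first by exists (p * p)%g, p, p.
move=> s _ [q [r [Lq Lr ->]]]; split.
  exists (s * q)%g, r; split=> //; last by rewrite mulgA.
  by apply: length_infinite_mul; right.
exists q, (r * s)%g; split=> //; last by rewrite mulgA.
by apply: length_infinite_mul; left.
Qed.

Definition power_length_words (A : choiceType) : set (word A) :=
  [set w | exists j, size (letters w) = 2 ^ j].

(* If |x| < |x'|, then |x'y| - |xy| does not depend on y, whereas the gaps
   between powers of 2 are unbounded. *)
Lemma power_length_words_mul (A : choiceType) (p q : beta (word A)) :
  length_infinite p -> length_infinite q ->
  ~ members (p * q)%g (@power_length_words A).
Proof.
move=> Lp Lq.
change (~ members p
  [set x | members q [set y | @power_length_words A (x * y)%g]]).
move=> pqB.
have [x qx] := filter_ex pqB.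
have [x' [qx' lx]] := filter_ex (filterI pqB (Lp (size (letters x)).+1)).
have [y [[[i yi] [j yj]]]] := filter_ex (filterI (filterI qx qx')
  (Lq (size (letters x')))).
move: yi yj lx; rewrite /= !size_cat => yi yj lx ly.
have lij : i < j by rewrite -(@ltn_exp2l 2) // -yi -yj ltn_add2r.
have : 2 ^ i.+1 <= 2 ^ j by rewrite leq_exp2l.
rewrite expnS -yi -yj mul2n -addnn leqNgt => /negP; apply.
have x_gt0 : 0 < size (letters x) by case: (x) => [[]].
apply: (@leq_ltn_trans (size (letters y) + size (letters y))).
  by rewrite leq_add2r.
by rewrite -addnACA -[X in X < _]add0n ltn_add2r addn_gt0 x_gt0.
Qed.

Lemma R_length_infinite (A : finType) (p : beta (word A)) : 0 < #|A| ->
  (forall n, 0 < n -> @R_ A n p) -> length_infinite p.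
Proof.
move=> /card_gt0P[a0 _] Rp m.
have [//|pC] := in_ultra_setVsetC [set w : word A | m <= size (letters w)]
  (members_ultra p).
exfalso.
have [w varw wC] := Rp m.+1 isT _ pC.
have := wC _ (ex_intro2 _ _ (nseq_tuple m.+1 a0) I erefl); apply => /=.
rewrite size_map ltnW // -[X in X <= _]size_enum_ord -(size_map (@inr A _)).
apply: uniq_leq_size; first by rewrite map_inj_uniq ?enum_uniq // => i j [].
by move=> _ /mapP[i _ ->]; exact: varw.
Qed.

Lemma power_length_words_partition (A : finType) (n : nat)
    (s : seq (set (word A))) : 0 < #|A| -> 0 < n ->
    @power_length_words A `<=` \bigcup_(C in [set` s]) C ->
  exists2 C, C \in s & @contains_variable_word A n C.
Proof.
move=> A_gt0 n_gt0 sB.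
have [N HJN] := @hales_jewett_multi A {ffun 'I_(size s) -> bool} n A_gt0 n_gt0.
pose c (u : seq A) := [ffun i : 'I_(size s) =>
  `[< exists2 w : word A, letters w = u & nth set0 s i w >]].
have [w [szw varw monow]] := HJN _ (ltnW (ltn_expl N (isT : 1 < 2))) c.
have w0 : w != [::] by rewrite -size_eq0 szw -lt0n expn_gt0.
have [a0 _] := card_gt0P A_gt0.
pose x0 := nseq_tuple n a0.
have [|C sC Cw] := sB (word_subst (Word w0) x0).
  by exists N; rewrite /= size_map.
exists C => //; exists (Word w0) => // _ [x _ <-].
have Cs : index C s < size s by rewrite index_mem.
have /ffunP/(_ (Ordinal Cs)) := monow x0 x.
rewrite !ffunE /= nth_index // => cE.
have : `[< exists2 v : word A, letters v = map (subst_letter x0) w & C v >].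
  by apply/asboolP; exists (word_subst (Word w0) x0).
rewrite cE => /asboolP[v vE].
by congr C; apply: val_inj.
Qed.

Lemma exists_R_power_length_words (A : finType) : 0 < #|A| ->
  exists2 p : beta (word A), members p (@power_length_words A) &
    forall n, 0 < n -> @R_ A n p.
Proof.
move=> A_gt0; pose B := @power_length_words A.
pose F : set_system (word A) := [set D | exists n (s : seq (set (word A))),
  [/\ 0 < n, {in s, forall C, ~ @contains_variable_word A n C} &
      B `<=` D `|` \bigcup_(C in [set` s]) C]].
have FF : ProperFilter F.
  apply: Build_ProperFilter.
    move=> [n [s [n_gt0 sn sB]]].
    have [|C sC Cn] := power_length_words_partition A_gt0 n_gt0 (s := s).
      by rewrite -[X in _ `<=` X]set0U.
    exact: (sn C).
  split.
  - by exists 1, [::]; split=> // w _; left.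
  - move=> D D' [n [s [n_gt0 sn sB]]] [n' [s' [n'_gt0 sn' sB']]].
    exists (n + n'), (s ++ s'); split; first by rewrite addn_gt0 n_gt0.
      move=> C; rewrite mem_cat => /orP[/sn|/sn'] nC.
        by move=> /(contains_variable_word_leq n_gt0 (leq_addr _ _)).
      by move=> /(contains_variable_word_leq n'_gt0 (leq_addl _ _)).
    move=> w Bw.
    have [Dw|[C sC Cw]] := sB _ Bw; last first.
      by right; exists C; rewrite //= mem_cat sC.
    have [D'w|[C sC Cw]] := sB' _ Bw; first by left.
    by right; exists C; rewrite //= mem_cat sC orbT.
  - move=> D D' DD' [n [s [n_gt0 sn sB]]]; exists n, s; split=> // w /sB[/DD'|].
      by left.
    by right.
have [G [GU FG]] := ultraFilterLemma FF.
exists (Beta GU); first by apply: FG; exists 1, [::]; split=> // w; left.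
move=> n n_gt0 D GD; apply: contrapT => nD.
apply: (@filter_not_empty _ G); rewrite -(setICr D); apply: filterI => //.
apply: FG; exists n, [:: D]; split=> //.
  by move=> C; rewrite inE => /eqP->.
move=> w _; have [Dw|] := pselect (D w); last by left.
by right; exists D; rewrite //= mem_head.
Qed.

Theorem theorem5p7 (A : finType) (A_nonempty : (0 < #|A|)%N) :
  closure (@smallest_ideal (beta (word A)))
    `<` \bigcap_(n in [set n : nat | (0 < n)%N]) @R_ A n.
Proof.
have [p pB Rp] := exists_R_power_length_words A_nonempty.
split=> [q Kq n n_gt0|sub].
  by apply: closure_smallest_ideal_sub_R Kq; exists p; exact: Rp.
have [q Kq] := closure_beta_meets (sub p Rp) pB.
have LI : two_sided_ideal _ :=
  length_infinite_products_ideal (ex_intro _ p (R_length_infinite A_nonempty Rp)).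
have [r [t [Lr Lt ->]]] := smallest_sub LI (@sub0set _ _) Kq.
exact: power_length_words_mul.
Qed.
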